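(* Let $X,Y$ be compact Hausdorff spaces and $E$ a unital Banach algebra with unit $e_0$. Let $H:C(X,E)\to C(Y,E)$ be a biseparating bijection with $\|H1_{e_0}(y)\|\ne0$ for all $y\in Y$, such that both $H$ and $H^{-1}:C(Y,E)\to C(X,E)$ are strongly pointwise subadditive. Then the support map $h:Y\to X$ of $H$ is a homeomorphism of $Y$ onto $X$, and the support map of $H^{-1}$ is $h^{-1}$.
   Context: $C(X,E)$ is the space of continuous functions $X\to E$ with the supremum norm. For $f\in C(X,E)$, $\operatorname{coz}(f)=\{x\in X:f(x)\ne0\}$. For $e\in E$, $1_e\in C(X,E)$ is the constant function with value $e$. Maps $H:C(X,E)\to C(Y,E)$ are not assumed linear. $H$ is separating if, for all $f,g\in C(X,E)$, $\|f(x)\|\,\|g(x)\|=0$ for all $x\in X$ implies $\|Hf(y)\|\,\|Hg(y)\|=0$ for all $y\in Y$. A bijection $H$ is biseparating if both $H$ and $H^{-1}$ are separating. $H$ is pointwise subadditive if $\|H(f+g)(y)\|\le\|Hf(y)\|+\|Hg(y)\|$ for all $f,g\in C(X,E)$, $y\in Y$. For $y\in Y$, $\hat y\circ H:C(X,E)\to E$ is $f\mapsto Hf(y)$. An open set $U\subseteq X$ is a vanishing set for $\hat y\circ H$ if for each $f\in C(X,E)$, $\operatorname{coz}(f)\subseteq U$ implies $Hf(y)=0$. The support is $\operatorname{supp}(\hat y\circ H)=X\setminus\bigcup\{V\subseteq X: V\text{ is a vanishing set for }\hat y\circ H\}$. When every $\operatorname{supp}(\hat y\circ H)$, $y\in Y$,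 is a singleton $\{h(y)\}$ (which holds for pointwise subadditive separating $H$ with $\|H1_{e_0}(y)\|\neq 0$ for all $y$), the map $h:Y\to X$ is called the support map of $H$. A pointwise subadditive separating map $H$ with support map $h$ is strongly pointwise subadditive if for each $y\in Y$ there is $M_y>0$, and for each $c\in E$ there is $\delta_{c,y}>0$, such that $\|Hf(y)-Hg(y)\|\le M_y\|H(f-g)(y)\|$ for all $f,g\in C(X,E)$ with $f(h(y))=c$ and $\|f(h(y))-g(h(y))\|<\delta_{c,y}$; in particular, calling a map strongly pointwise subadditive presupposes that its support map exists. The same definitions apply to $H^{-1}$ with the roles of $X$ and $Y$ exchanged. *)

(* Defs.v *)
From HB Require Import structures.
From mathcomp Require Import all_boot all_order all_algebra.
From mathcomp Require Import all_classical all_reals all_analysis.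
From mathcomp Require Import complex.

Set Implicit Arguments.
Unset Strict Implicit.
Unset Printing Implicit Defensive.

Import Order.TTheory GRing.Theory Num.Theory.
Import numFieldNormedType.Exports.

Local Open Scope classical_set_scope.
Local Open Scope ring_scope.

(* [complex R] carries its own [numFieldType] structure, with the modulus as
   (complex-valued) norm; in a normed module over it, norms and the bounds
   [0 < M] are elements of [complex R] that are automatically real. *)
Inductive real_or_complex : numFieldType -> Prop :=
| real_scalars (R : realType) : real_or_complex R
| complex_scalars (R : realType) : real_or_complex (complex R).

(* No Hierarchy Builder structure can join [GRing.Algebra] with [NormedModule]
   here (the join would have to sit below [Num.NumDomain]), so the product is
   carried explicitly.  The normalisation [`|e0| = 1] is not imposed, so that
   both usual conventions for unital Banach algebras are covered. *)
Record unital_banach_algebra (K : numFieldType) (E : completeNormedModType K)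
    (mul : E -> E -> E) (e0 : E) : Prop := UnitalBanachAlgebra {
  banach_mulA : associative mul;
  banach_mul1l : left_id e0 mul;
  banach_mul1r : right_id e0 mul;
  banach_mulDl : left_distributive mul +%R;
  banach_mulDr : right_distributive mul +%R;
  banach_mulZl : forall (a : K) (x y : E), mul (a *: x) y = a *: mul x y;
  banach_mulZr : forall (a : K) (x y : E), mul x (a *: y) = a *: mul x y;
  banach_normM : forall x y : E, `|mul x y| <= `|x| * `|y|
}.

Section ContinuousFunctions.
Context (K : numFieldType) (X : topologicalType) (E : normedModType K).
Implicit Types f g : continuousType X E.

Lemma cts_add_subproof f g : continuous (f \+ g).
Proof. by move=> x; apply: cvgD; exact: cts_fun. Qed.

Lemma cts_opp_subproof f : continuous (\- f).
Proof. by move=> x; apply: cvgN; exact: cts_fun. Qed.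

Definition cts_add f g : continuousType X E := mkcts (@cts_add_subproof f g).
Definition cts_opp f : continuousType X E := mkcts (@cts_opp_subproof f).
Definition cts_zero : continuousType X E := cst 0.

Lemma cts_addA : associative cts_add.
Proof. by move=> f g k; apply/continuousEP => x; exact: addrA. Qed.

Lemma cts_addC : commutative cts_add.
Proof. by move=> f g; apply/continuousEP => x; exact: addrC. Qed.

Lemma cts_add0 : left_id cts_zero cts_add.
Proof. by move=> f; apply/continuousEP => x; exact: add0r. Qed.

Lemma cts_addN : left_inverse cts_zero cts_opp cts_add.
Proof. by move=> f; apply/continuousEP => x; exact: addNr. Qed.

HB.instance Definition _ := GRing.isZmodule.Build (continuousType X E)
  cts_addA cts_addC cts_add0 cts_addN.

Lemma cts_addE f g x : (f + g) x = f x + g x. Proof. by []. Qed.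
Lemma cts_subE f g x : (f - g) x = f x - g x. Proof. by []. Qed.

End ContinuousFunctions.

Section SupportMap.
Context (K : numFieldType) (X Y : topologicalType) (E : normedModType K).

Definition coz (f : continuousType X E) : set X := [set x | f x != 0].

Definition hat (y : Y) : continuousType Y E -> E := fun g => g y.

Definition vanishing_set (phi : continuousType X E -> E) (U : set X) : Prop :=
  open U /\ forall f : continuousType X E, coz f `<=` U -> phi f = 0.

Definition supp (phi : continuousType X E -> E) : set X :=
  ~` (\bigcup_(V in vanishing_set phi) V).

Definition is_support_map (H : continuousType X E -> continuousType Y E)
    (h : Y -> X) : Prop :=
  forall y : Y, supp (hat y \o H) = [set h y].

Definition separating (H : continuousType X E -> continuousType Y E) : Prop :=
  forall f g : continuousType X E, (forall x, `|f x| * `|g x| = 0) ->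
  forall y, `|H f y| * `|H g y| = 0.

Definition pointwise_subadditive
    (H : continuousType X E -> continuousType Y E) : Prop :=
  forall (f g : continuousType X E) (y : Y),
    `|H (f + g) y| <= `|H f y| + `|H g y|.

(* The support map [h] is unique when it exists, hence the existential. *)
Definition strongly_pointwise_subadditive
    (H : continuousType X E -> continuousType Y E) : Prop :=
  [/\ pointwise_subadditive H, separating H &
      exists2 h : Y -> X, is_support_map H h &
        forall y : Y, exists2 M : K, 0 < M &
          forall c : E, exists2 delta : K, 0 < delta &
            forall f g : continuousType X E, f (h y) = c ->
              `|f (h y) - g (h y)| < delta ->
              `|H f y - H g y| <= M * `|H (f - g) y|].

End SupportMap.

Definition biseparating (K : numFieldType) (X Y : topologicalType)
    (E : normedModType K) (H : continuousType X E -> continuousType Y E)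
    (Hinv : continuousType Y E -> continuousType X E) : Prop :=
  [/\ cancel H Hinv, cancel Hinv H, separating H & separating Hinv].

Definition homeomorphism_with_inverse (X Y : topologicalType)
    (h : Y -> X) (hinv : X -> Y) : Prop :=
  [/\ cancel h hinv, cancel hinv h, continuous h & continuous hinv].

(* Main.v *)
(** A point [a] of the support of [hat y \o H] sees functions [g] concentrated
    arbitrarily near [a] with [H g y != 0]; as [H] is separating, [H f y = 0] as
    soon as [f] vanishes near [a].  These two facts make [h] continuous: near [y]
    the function [H g] does not vanish, so [h] stays in the closure of [coz g].
    If [h (k x) != x], choose disjoint neighbourhoods [U] of [x] and [V] of
    [h (k x)], a function [g] concentrated in [h @^-1` V] with [Hinv g x != 0],
    and by Urysohn a function [f] concentrated in [U] with [f x != 0].  Then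
    [H f] and [g] have disjoint cozero sets while [f] and [Hinv g] are both
    nonzero at [x], contradicting that [Hinv] is separating. *)
Require Import Defs.
From HB Require Import structures.
From mathcomp Require Import all_boot all_order all_algebra.
From mathcomp Require Import all_classical all_reals all_analysis.
From mathcomp Require Import complex.

Set Implicit Arguments.
Unset Strict Implicit.
Unset Printing Implicit Defensive.

Import Order.TTheory GRing.Theory Num.Theory.
Import numFieldNormedType.Exports.

Local Open Scope classical_set_scope.
Local Open Scope ring_scope.

Lemma continuous_real_complex (R : realType) :
  continuous (real_complex R : R -> (R[i] : numFieldType)).
Proof.
move=> x; apply/cvgrPdist_lt => e e0.
(* A positive element of [R[i]] is real, so the estimate reduces to one in [R]. *)
have /complex_realP[r er] : e \is Num.real by exact: gtr0_real.
have r0 : 0 < r by rewrite -ltcR -er.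
near=> t.
have xtr : `|x - t| < r.
  by near: t; exact: (@cvgr_dist_lt _ _ _ (nbhs x) _ id x cvg_id).
by rewrite -rmorphB normc_def /= expr0n addr0 sqrtr_sqr er ltcR.
Unshelve. all: by end_near. Qed.

(** Urysohn functions are real-valued; [i] carries them into the scalars of [E]. *)
Lemma real_or_complex_embedding (K : numFieldType) : real_or_complex K ->
  exists (R : realType) (i : R -> K), [/\ continuous i, i 0 = 0 & i 1 = 1].
Proof.
case=> R; exists R; first by exists id; split => // x; exact: cvg_id.
by exists (real_complex R); split => //; exact: continuous_real_complex.
Qed.

(** Take [(1 - u) *: e], with [u] a Urysohn function equal to 0 at [x] and 1 off [U]. *)
Lemma compact_hausdorff_bump (K : numFieldType) (X : topologicalType)
    (E : normedModType K) (U : set X) (x : X) (e : E) :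
  real_or_complex K -> compact [set: X] -> hausdorff_space X ->
  open U -> U x -> exists2 f : continuousType X E, f x = e & coz f `<=` U.
Proof.
move=> /real_or_complex_embedding[R [i [i_cts i0 i1]]] cptX hausX oU Ux.
have sep : uniform_separator [set x] (~` U).
  apply: (@normal_completely_regular R) => //.
  - exact: compact_normal.
  - exact: hausdorff_accessible.
  - exact: open_closedC.
pose u : X -> R := Urysohn [set x] (~` U).
have u_cts : continuous u by exact: Urysohn_continuous.
have f_cts : continuous (fun z => (1 - i (u z)) *: e).
  move=> z; apply: cvgZr_tmp; apply: cvgB; first exact: cvg_cst.
  exact: (continuous_comp (u_cts z) (i_cts (u z))).
exists (mkcts f_cts) => [|z]; rewrite /coz /= /mkcts.
  have -> : u x = 0 by apply: (Urysohn_sub0 sep); exists x.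
  by rewrite i0 subr0 scale1r.
apply: contraPP => nUz; apply/negP; rewrite negbK.
have -> : u z = 1 by apply: (Urysohn_sub1 sep); exists z.
by rewrite i1 subrr scale0r.
Qed.

Lemma open_coz (K : numFieldType) (X : topologicalType) (E : normedModType K)
    (f : continuousType X E) : open (coz f).
Proof.
apply: (open_comp (f := f) (D := [set e | e != 0])) => [x _|].
  exact: cts_fun.
have -> : [set e : E | e != 0] = ~` [set 0].
  by apply/seteqP; split=> e /= /eqP.
by apply: closed_openC; apply: accessible_closed_set1;
  apply: hausdorff_accessible; exact: norm_hausdorff.
Qed.

(** Otherwise [U] would be a vanishing set containing [a]. *)
Lemma supp_nonvanishing (K : numFieldType) (X : topologicalType)
    (E : normedModType K) (phi : continuousType X E -> E) (a : X) (U : set X) :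
  supp phi a -> open U -> U a ->
  exists2 f : continuousType X E, coz f `<=` U & phi f != 0.
Proof.
move=> supp_a oU Ua; apply: contrapT => none; apply: supp_a.
exists U => //; split=> // f fU.
by apply/eqP; apply: contrapT => /negP phif; apply: none; exists f.
Qed.

Section SupportMaps.
Context (K : numFieldType) (X Y : topologicalType) (E : normedModType K).
Implicit Types (H : continuousType X E -> continuousType Y E).

Lemma separating_eq0_near_supp H (f : continuousType X E) (a : X) (y : Y) :
  separating H -> supp (hat y \o H) a -> nbhs a [set x | f x = 0] -> H f y = 0.
Proof.
move=> sepH supp_a; rewrite nbhsE /= => -[U [oU Ua] fU].
have [g gU Hgy] := supp_nonvanishing supp_a oU Ua.
have fg x : `|f x| * `|g x| = 0.
  have [->|gx] := eqVneq (g x) 0; first by rewrite normr0 mulr0.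
  by rewrite (fU _ (gU _ gx)) normr0 mul0r.
have /eqP := sepH _ _ fg y.
by rewrite mulf_eq0 !normr_eq0 => /orP[/eqP //|]; rewrite (negPf Hgy).
Qed.

Lemma support_map_continuous H (h : Y -> X) :
  compact [set: X] -> hausdorff_space X -> separating H ->
  is_support_map H h -> continuous h.
Proof.
move=> cptX hausX sepH supph y.
have supp_h z : supp (hat z \o H) (h z) by rewrite supph.
(* Regularity leaves room between [V] and the complement of [B]: [closure V] lies in [B]. *)
move=> B /(compact_regular hausX cptX filterT)[A + clAB].
rewrite nbhsE /= => -[V [oV Vhy] VA].
have [f fV Hfy] := supp_nonvanishing (supp_h y) oV Vhy.
have := open_nbhs_nbhs (conj (open_coz (H f)) Hfy).
apply: filterS => z; apply: contraPP => /= nBhz; apply/negP; rewrite negbK.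
apply/eqP/(separating_eq0_near_supp sepH (supp_h z)).
have : nbhs (h z) (~` closure V).
  apply: open_nbhs_nbhs; split; first exact/closed_openC/closed_closure.
  by move=> /(closureS VA)/clAB.
apply: filterS => x nVx; apply: contrapT => /eqP fx; apply: nVx.
exact/subset_closure/fV.
Qed.

Lemma support_map_cancel H (Hinv : continuousType Y E -> continuousType X E)
    (h : Y -> X) (k : X -> Y) :
  real_or_complex K -> compact [set: X] -> hausdorff_space X ->
  biseparating H Hinv -> is_support_map H h -> is_support_map Hinv k ->
  cancel k h.
Proof.
move=> hK cptX hausX [HK _ sepH sepHinv] supph suppk x.
have supp_h z : supp (hat z \o H) (h z) by rewrite supph.
have supp_k z : supp (hat z \o Hinv) (k z) by rewrite suppk.
have h_cts := support_map_continuous cptX hausX sepH supph.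
apply/eqP; apply: contrapT => /negP hkx.
have := hausX; rewrite open_hausdorff => /(_ _ _ hkx)[[V U] /=].
rewrite !inE => -[Vhkx Ux] [oV oU VU0].
have oW : open (h @^-1` V) by apply: open_comp => // z _; exact: h_cts.
have [g gW Hinvgx] := supp_nonvanishing (supp_k x) oW Vhkx.
(* Prescribing the value [Hinv g x] at [x] makes the final product the square of one nonzero
   norm. *)
have [f fx fU] := compact_hausdorff_bump (Hinv g x) hK cptX hausX oU Ux.
have Hfg z : `|H f z| * `|g z| = 0.
  have [->|gz] := eqVneq (g z) 0; first by rewrite normr0 mulr0.
  (* Where [g z != 0], the point [h z] lies in [V], on which [f] vanishes because [V] misses [U]. *)
  rewrite (separating_eq0_near_supp sepH (supp_h z)) ?normr0 ?mul0r //.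
  apply: filterS (open_nbhs_nbhs (conj oV (gW _ gz))) => t Vt.
  apply: contrapT => /eqP/fU Ut.
  by have : (V `&` U) t by []; rewrite VU0.
have /eqP := sepHinv _ _ Hfg x.
by rewrite HK fx mulf_eq0 orbb normr_eq0 (negPf Hinvgx).
Qed.

End SupportMaps.

Theorem theorem2p12 (K : numFieldType) (hK : real_or_complex K)
    (X Y : topologicalType)
    (E : completeNormedModType K) (mul : E -> E -> E) (e0 : E)
    (algE : unital_banach_algebra mul e0)
    (cptX : compact [set: X]) (hausX : hausdorff_space X)
    (cptY : compact [set: Y]) (hausY : hausdorff_space Y)
    (H : continuousType X E -> continuousType Y E)
    (Hinv : continuousType Y E -> continuousType X E)
    (bisepH : biseparating H Hinv)
    (H1_neq0 : forall y : Y, `|H (cst e0) y| != 0)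
    (strongH : strongly_pointwise_subadditive H)
    (strongHinv : strongly_pointwise_subadditive Hinv)
    (h : Y -> X) (supph : is_support_map H h) :
  exists2 hinv : X -> Y,
    homeomorphism_with_inverse h hinv & is_support_map Hinv hinv.
Proof.
(* The candidate inverse is the support map [k] of [Hinv]. *)
case: strongHinv => _ _ [k suppk _].
have [HK HinvK sepH sepHinv] := bisepH.
exists k => //; split.
(* Being biseparating is symmetric, so the roles of [H] and [Hinv] may be exchanged. *)
- exact: (support_map_cancel hK cptY hausY _ suppk supph).
- exact: (support_map_cancel hK cptX hausX bisepH supph suppk).
- exact: (support_map_continuous cptX hausX sepH supph).
- exact: (support_map_continuous cptY hausY sepHinv suppk).
Qed.
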